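(* Let $\Theta_0,\Theta_1\subset\Lambda$. There is a consistent sequence of tests for $H_0: P\in\Theta_0$ versus $H_1: P\in\Theta_1$ if and only if there are nested subsets $\Theta_{1i}\subseteq\Theta_{1,i+1}$, $i=1,2,\ldots$, with $\Theta_1=\bigcup_{i=1}^\infty\Theta_{1i}$, such that, for each $i$, the hypothesis $H_0: P\in\Theta_0$ and the alternative $H_{1i}: P\in\Theta_{1i}$ are distinguishable.
   Context: $\Omega$ is a topological space with Borel $\sigma$-field $\mathfrak{B}$, and $\Lambda$ is the set of all probability measures on $(\Omega,\mathfrak{B})$. One observes i.i.d. random variables $X_1,\ldots,X_n$ with values in $\Omega$ and distribution $P\in\Lambda$. A test $K_n$ is a measurable function of $(X_1,\ldots,X_n)$ with values in $[0,1]$ (the probability of rejecting the hypothesis). For a hypothesis $P\in\Theta_0$ and an alternative $P\in\Theta_1$, put $\alpha_P(K_n)=E_P[K_n]$ for $P\in\Theta_0$, $\beta_P(K_n)=E_P[1-K_n]$ for $P\in\Theta_1$, $\alpha(K_n)=\sup_{P\in\Theta_0}\alpha_P(K_n)$, $\beta(K_n)=\sup_{P\in\Theta_1}\beta_P(K_n)$. A sequence of tests $K_n$ is consistent if $\lim_{n\to\infty}\alpha(K_n)=0$ and $\lim_{n\to\infty}\beta_P(K_n)=0$ for every $P\in\Theta_1$. It is uniformly consistent if $\lim_{n\to\infty}\alpha(K_n)=0$ and $\lim_{n\to\infty}\beta(K_n)=0$. A hypothesis and an alternative are distinguishable if there is a uniformly consistent sequence of tests for them. *)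

(* Defs.v *)
From HB Require Import structures.
From mathcomp Require Import all_boot all_order all_algebra.
From mathcomp Require Import all_classical all_reals all_analysis.

Set Implicit Arguments.
Unset Strict Implicit.
Unset Printing Implicit Defensive.

Import Order.TTheory GRing.Theory Num.Theory.
Import numFieldNormedType.Exports.

Local Open Scope classical_set_scope.
Local Open Scope ring_scope.

Notation borel Omega := (g_sigma_algebraType (@open Omega)).

Section iid_law.
Context d (T : measurableType d) (R : realType) (P : probability T R).

Definition tuple_cons n (x : T * n.-tuple T) : n.+1.-tuple T :=
  [tuple of x.1 :: x.2].

Lemma measurable_tuple_cons n : measurable_fun setT (@tuple_cons n).
Proof. exact: measurable_cons. Qed.

HB.instance Definition _ n :=
  isMeasurableFun.Build _ _ _ _ (@tuple_cons n) (@measurable_tuple_cons n).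

(* The n-fold product measure P^n, i.e. the joint law of n i.i.d. random
   variables with distribution P; see iid_law_box. *)
Fixpoint iid_law n : probability (n.-tuple T) R :=
  if n is m.+1 then distribution (P \x iid_law m)%E (@tuple_cons m)
  else \d_[tuple].

Lemma iid_law_box n (A : 'I_n -> set T) : (forall i, measurable (A i)) ->
  iid_law n [set x | forall i, A i (tnth x i)] = (\prod_(i < n) P (A i))%E.
Proof.
have mbox m (B : 'I_m -> set T) : (forall i, measurable (B i)) ->
    measurable [set x : m.-tuple T | forall i, B i (tnth x i)].
  move=> mB; have -> : [set x : m.-tuple T | forall i, B i (tnth x i)] =
      \bigcap_(i in [set: 'I_m]) ((@tnth m T ^~ i) @^-1` B i).
    by apply/seteqP; split=> x h i; [move=> _; apply: h|apply: (h i I)].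
  apply: fin_bigcap_measurable => // i _.
  by rewrite -[X in measurable X]setTI; exact: measurable_tnth.
elim: n A => [|n IH] A mA.
  by rewrite big_ord0 /= diracE mem_set// => -[].
rewrite big_ord_recl -IH// -product_measure1E//; last first.
  by apply: (mbox _ (fun i => A (lift ord0 i))) => i; exact: mA.
rewrite /= /distribution /pushforward; congr (product_measure1 _ _ _).
apply/seteqP; split=> [[x t] /= h|[x t] /= [h0 h] i].
  by split=> [|i]; [have := h ord0|have := h (lift ord0 i); rewrite tnthS].
by case: (unliftP ord0 i) => [j ->|->]; rewrite ?tnthS.
Qed.

End iid_law.

Section tests.
Context d (T : measurableType d) (R : realType).
Implicit Types (P : probability T R) (Theta : set (probability T R)).

Definition is_test n (K : n.-tuple T -> R) :=
  measurable_fun setT K /\ forall x, 0 <= K x <= 1.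

Definition alphaP n (K : n.-tuple T -> R) P : R := fine 'E_(iid_law P n)[K].

Definition betaP n (K : n.-tuple T -> R) P : R :=
  fine 'E_(iid_law P n)[fun x => 1 - K x].

(* The suprema are taken in R, so that the supremum over an empty family of
   distributions is 0 (lemma sup0), the least possible value of an error
   probability, instead of -oo. *)
Definition alpha n (K : n.-tuple T -> R) Theta0 : R :=
  sup [set alphaP K P | P in Theta0].

Definition beta n (K : n.-tuple T -> R) Theta1 : R :=
  sup [set betaP K P | P in Theta1].

Definition consistent Theta0 Theta1 (K : forall n, n.-tuple T -> R) :=
  alpha (K n) Theta0 @[n --> \oo] --> 0 /\
  forall P, Theta1 P -> betaP (K n) P @[n --> \oo] --> 0.

Definition uniformly_consistent Theta0 Theta1
    (K : forall n, n.-tuple T -> R) :=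
  alpha (K n) Theta0 @[n --> \oo] --> 0 /\
  beta (K n) Theta1 @[n --> \oo] --> 0.

Definition distinguishable Theta0 Theta1 :=
  exists K : forall n, n.-tuple T -> R,
    (forall n, is_test (K n)) /\ uniformly_consistent Theta0 Theta1 K.

End tests.

(* Main.v *)
Require Import Defs.
From HB Require Import structures.
From mathcomp Require Import all_boot all_order all_algebra.
From mathcomp Require Import all_classical all_reals all_analysis.
From mathcomp Require Import measurable_realfun lra.

(** A consistent sequence [K] controls the first kind error uniformly and the
second kind error pointwise. Cutting the alternative into the sets
$\Theta_{1i}$ of those $P$ with $\beta_P(K_n) \le 1/2$ for all $n \ge i$, one
gets a uniform bound on both errors, but on each piece the second one is only
known to be at most 1/2. It is brought down to 0 by repetition: split the
sample into $k$ independent blocks of length $m$, run $K_m$ on each of them,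
and reject as soon as one block rejects. The second kind error is then at most
$2^{-k}$, because the errors of independent blocks multiply
([betaP_reject_either]), and the first kind error is at most $k\alpha(K_m)$,
which is small because $m$ may be chosen after $k$ ([separable_amplify]).
The probabilistic input is the independence of the blocks of an i.i.d. sample
([ge0_integral_iid_law_blocks]).

Such statements produce, for each level of error, a test for every large sample
size. A sequence of tests is obtained from them by a diagonal argument
([diagonal_test]): at sample size $n$ use the test made for the piece
$\Theta_{1s}$ and the level $1/(s+1)$, where $s = s(n)$ tends to infinity so
slowly that this test exists. As the pieces are nested, the resulting sequence
is uniformly consistent against every $\Theta_{1i}$. For a constant sequence of
pieces this gives distinguishability, and for the pieces assumed in the
converse implication it gives a consistent sequence, since each $P$ in
$\Theta_1$ lies in one of the pieces. *)

Set Implicit Arguments.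
Unset Strict Implicit.
Unset Printing Implicit Defensive.

Import Order.TTheory GRing.Theory Num.Theory.
Import numFieldNormedType.Exports.

Local Open Scope classical_set_scope.
Local Open Scope ring_scope.

(** * Independence of the blocks of an i.i.d. sample *)

Section blocks.
Context d (T : measurableType d).

Definition first_block m l (x : (m + l).-tuple T) : m.-tuple T :=
  [tuple tnth x (lshift l i) | i < m].

Definition last_block m l (x : (m + l).-tuple T) : l.-tuple T :=
  [tuple tnth x (rshift m i) | i < l].

Lemma measurable_first_block m l : measurable_fun setT (@first_block m l).
Proof.
apply/measurable_fun_tnthP => i.
rewrite [X in measurable_fun _ X](_ : _ = (@tnth _ T)^~ (lshift l i)).
  exact: measurable_tnth.
by apply/funext => x /=; rewrite tnth_mktuple.
Qed.

Lemma measurable_last_block m l : measurable_fun setT (@last_block m l).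
Proof.
apply/measurable_fun_tnthP => i.
rewrite [X in measurable_fun _ X](_ : _ = (@tnth _ T)^~ (rshift m i)).
  exact: measurable_tnth.
by apply/funext => x /=; rewrite tnth_mktuple.
Qed.

Lemma last_block0 l (t : (0 + l).-tuple T) : last_block t = t.
Proof.
apply: eq_from_tnth => i; rewrite tnth_mktuple.
by congr (tnth t _); exact: val_inj.
Qed.

Lemma first_block_cons m l (x : T) (t : (m + l).-tuple T) :
  first_block (tuple_cons (x, t) : (m.+1 + l).-tuple T) =
  tuple_cons (x, first_block t).
Proof.
apply: eq_from_tnth => i; rewrite tnth_mktuple.
case: (unliftP ord0 i) => [j ->|->].
  have -> : lshift l (lift ord0 j : 'I_m.+1) =
      (lift ord0 (lshift l j : 'I_(m + l)) : 'I_(m + l).+1) by exact: val_inj.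
  by rewrite !tnthS tnth_mktuple.
by rewrite (_ : lshift l ord0 = ord0)//; exact: val_inj.
Qed.

Lemma last_block_cons m l (x : T) (t : (m + l).-tuple T) :
  last_block (tuple_cons (x, t) : (m.+1 + l).-tuple T) = last_block t.
Proof.
apply: eq_from_tnth => i; rewrite !tnth_mktuple.
have -> : rshift m.+1 i = (lift ord0 (rshift m i) : 'I_(m + l).+1).
  exact: val_inj.
by rewrite tnthS.
Qed.

Context (R : realType) (P : probability T R).
Local Open Scope ereal_scope.

(** Conditioning on the first observation; this makes induction on the sample
size available for integrals. *)
Lemma ge0_integral_iid_lawS n (g : n.+1.-tuple T -> \bar R) :
  measurable_fun setT g -> (forall t, 0 <= g t) ->
  \int[iid_law P n.+1]_t g t =
  \int[P]_x \int[iid_law P n]_t g (tuple_cons (x, t)).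
Proof.
move=> mg g0; rewrite /= ge0_integral_distribution// fubini_tonelli1//; last first.
  by move=> z; exact: g0.
by apply: measurableT_comp => //; exact: measurable_tuple_cons.
Qed.

(** Independence of the first [m] and the last [l] observations, by induction on
[m]: peeling off the first observation leaves the factor [g] unchanged, so that
it can be pulled out of the outer integral. Working with nonnegative extended
real functions avoids integrability conditions. *)
Lemma ge0_integral_iid_law_blocks m l
    (f : m.-tuple T -> \bar R) (g : l.-tuple T -> \bar R) :
  measurable_fun setT f -> (forall t, 0 <= f t) ->
  measurable_fun setT g -> (forall t, 0 <= g t) ->
  \int[iid_law P (m + l)]_t (f (first_block t) * g (last_block t)) =
  \int[iid_law P m]_t f t * \int[iid_law P l]_t g t.
Proof.
move=> + + mg g0; elim: m f => [|m IH] f mf f0.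
  rewrite /= integral_dirac// diracE mem_set// mul1e -ge0_integralZl//.
  by apply: eq_integral => t _; rewrite [first_block t]tuple0 last_block0.
have mfcons : measurable_fun setT (f \o @tuple_cons _ T m).
  by apply: measurableT_comp => //; exact: measurable_tuple_cons.
rewrite [X in X = _](@ge0_integral_iid_lawS (m + l)); first last.
- by move=> t; rewrite mule_ge0.
- apply: emeasurable_funM.
    by apply: measurableT_comp => //; exact: (@measurable_first_block m.+1).
  by apply: measurableT_comp => //; exact: (@measurable_last_block m.+1).
rewrite ge0_integral_iid_lawS// -ge0_integralZr//; first last.
- exact: integral_ge0.
- by move=> x _; exact: integral_ge0.
- apply: (measurable_fun_fubini_tonelli_F (m2 := iid_law P m) _ mfcons) => z.
  exact: f0.
apply: eq_integral => x _.
rewrite -(IH (fun t => f (tuple_cons (x, t))))//.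
  by apply: eq_integral => t _; rewrite first_block_cons last_block_cons.
exact: measurable_fun_pair2 mfcons.
Qed.

End blocks.

(** * Error probabilities and their behaviour under repetition *)

Section errors.
Context d (T : measurableType d) (R : realType).
Implicit Types (P : probability T R) (Theta : set (probability T R)).

Lemma is_testC n (K : n.-tuple T -> R) :
  is_test K -> is_test (fun x => 1 - K x).
Proof.
move=> [mK K01]; split; first exact: measurable_funB.
by move=> x; have := K01 x; lra.
Qed.

Lemma expectation_test n (K : n.-tuple T -> R) P : is_test K ->
  ('E_(iid_law P n)[K] = (alphaP K P)%:E)%E.
Proof.
move=> [mK K01]; rewrite /alphaP fineK//.
rewrite expectation_fin_num//; apply/Lfun1_integrable.
apply: measurable_bounded_integrable => //.
  exact: (le_lt_trans (probability_le1 (iid_law P n) measurableT) (ltry _)).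
exists 1; split=> // M M1 x _ /=.
by rewrite ger0_norm; have := K01 x; lra.
Qed.

(** This lets everything about the first kind error be read off from the second
kind error. *)
Lemma betaP_alphaP n (K : n.-tuple T -> R) P : is_test K ->
  betaP K P = 1 - alphaP K P.
Proof.
move=> tK; have tC := is_testC tK.
have E : (alphaP (fun x => (1 - K x)%R) P + alphaP K P = 1)%R; last first.
  by rewrite -{}E addrK.
apply: EFin_inj; rewrite EFinD -!expectation_test//.
case: tK tC => mK K01 [mC C01].
rewrite unlock -ge0_integralD//=.
- under eq_integral do rewrite -EFinD subrK.
  by rewrite integral_cst// mul1e; exact: (probability_setT (iid_law P n)).
- by move=> x _; rewrite lee_fin; have /andP[] := C01 x.
- exact/measurable_EFinP.
- by move=> x _; rewrite lee_fin; have /andP[] := K01 x.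
- exact/measurable_EFinP.
Qed.

Lemma alphaP_ge0 n (K : n.-tuple T -> R) P : is_test K -> 0 <= alphaP K P.
Proof.
move=> tK; rewrite -lee_fin -expectation_test//.
by apply: expectation_ge0 => x; have [_ /(_ x)/andP[]] := tK.
Qed.

Lemma betaP_ge0 n (K : n.-tuple T -> R) P : is_test K -> 0 <= betaP K P.
Proof. by move=> tK; apply: alphaP_ge0; exact: is_testC. Qed.

(** With 0-1 valued tests this rejects exactly when [K] rejects on the first
block or [L] on the last one; for randomized tests it is the probability that
at least one of two independent randomizations rejects. *)
Definition reject_either m l (K : m.-tuple T -> R) (L : l.-tuple T -> R)
    (x : (m + l).-tuple T) : R :=
  1 - (1 - K (first_block x)) * (1 - L (last_block x)).

Lemma is_test_reject_either m l (K : m.-tuple T -> R) (L : l.-tuple T -> R) :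
  is_test K -> is_test L -> is_test (reject_either K L).
Proof.
move=> tK tL; apply: (is_testC (K := fun x =>
  (1 - K (first_block x)) * (1 - L (last_block x)))).
have [mK K01] := is_testC tK; have [mL L01] := is_testC tL.
split=> [|x].
  apply: measurable_funM.
    exact: (measurableT_comp mK (@measurable_first_block _ T m l)).
  exact: (measurableT_comp mL (@measurable_last_block _ T m l)).
have /andP[? ?] := K01 (first_block x).
have /andP[? ?] := L01 (last_block x).
by rewrite mulr_ge0//= mulr_ile1.
Qed.

(** Both tests have to accept, and they act on independent blocks. *)
Lemma betaP_reject_either m l (K : m.-tuple T -> R) (L : l.-tuple T -> R) P :
  is_test K -> is_test L ->
  betaP (reject_either K L) P = betaP K P * betaP L P.
Proof.
move=> tK tL; have tE := is_testC (is_test_reject_either tK tL).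
have {}tK := is_testC tK; have {}tL := is_testC tL.
apply: EFin_inj; rewrite EFinM -!expectation_test// unlock.
rewrite -(@ge0_integral_iid_law_blocks _ T R P m l
  (fun x => (1 - K x)%:E) (fun x => (1 - L x)%:E)).
- by apply: eq_integral => x _; rewrite -EFinM /reject_either subKr.
- by apply/measurable_EFinP; case: tK.
- by move=> x; rewrite lee_fin; have [_ /(_ x)/andP[]] := tK.
- by apply/measurable_EFinP; case: tL.
- by move=> x; rewrite lee_fin; have [_ /(_ x)/andP[]] := tL.
Qed.

(** The union bound, in the form $1 - (1-a)(1-b) = a + b - ab \le a + b$. *)
Lemma alphaP_reject_either m l (K : m.-tuple T -> R) (L : l.-tuple T -> R) P :
  is_test K -> is_test L ->
  alphaP (reject_either K L) P <= alphaP K P + alphaP L P.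
Proof.
move=> tK tL; have := betaP_reject_either P tK tL.
rewrite !betaP_alphaP//; last exact: is_test_reject_either.
have := mulr_ge0 (alphaP_ge0 P tK) (alphaP_ge0 P tL).
nra.
Qed.

Definition separates Theta0 Theta1 n (a b : R) (K : n.-tuple T -> R) :=
  (forall P, Theta0 P -> alphaP K P <= a) /\
  (forall P, Theta1 P -> betaP K P <= b).

Definition separable Theta0 Theta1 n (a b : R) :=
  exists2 K : n.-tuple T -> R, is_test K & separates Theta0 Theta1 a b K.

(** The test that never rejects. *)
Lemma separable01 Theta0 Theta1 n : separable Theta0 Theta1 n 0 1.
Proof.
have t0 : is_test (fun _ : n.-tuple T => 0 : R).
  by split=> [|x]; [exact: measurable_cst|rewrite lexx ler01].
have a0 P : alphaP (fun _ : n.-tuple T => 0 : R) P = 0.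
  by rewrite /alphaP [X in fine X](expectation_cst (iid_law P n) 0).
exists (fun=> 0) => //; split=> P _; first by rewrite a0.
by rewrite betaP_alphaP// a0 subr0.
Qed.

Lemma separableD Theta0 Theta1 m l (a a' b b' : R) :
  separable Theta0 Theta1 m a b -> separable Theta0 Theta1 l a' b' ->
  separable Theta0 Theta1 (m + l) (a + a') (b * b').
Proof.
move=> [K tK [Ka Kb]] [L tL [La Lb]].
exists (reject_either K L); first exact: is_test_reject_either.
split=> P ThP.
  apply: le_trans (alphaP_reject_either P tK tL) _.
  by rewrite lerD ?Ka ?La.
by rewrite betaP_reject_either// ler_pM ?Kb ?Lb ?betaP_ge0.
Qed.

(** Extra observations can be ignored: run on them the test that never rejects,
which adds 0 to one error and multiplies the other one by 1. *)
Lemma separable_widen Theta0 Theta1 m n (a b : R) : (m <= n)%N ->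
  separable Theta0 Theta1 m a b -> separable Theta0 Theta1 n a b.
Proof.
move=> /subnKC <- sep.
by have := separableD sep (separable01 Theta0 Theta1 (n - m)); rewrite addr0 mulr1.
Qed.

Lemma separable_repeat Theta0 Theta1 m k (a b : R) :
  separable Theta0 Theta1 m a b ->
  separable Theta0 Theta1 (k * m) (a *+ k) (b ^+ k).
Proof.
move=> sep; elim: k => [|k IH]; first exact: separable01.
by rewrite mulSn mulrS exprS; exact: separableD.
Qed.

Lemma separableW Theta0 Theta1 n (a a' b b' : R) : a <= a' -> b <= b' ->
  separable Theta0 Theta1 n a b -> separable Theta0 Theta1 n a' b'.
Proof.
move=> aa' bb' [K tK [Ka Kb]]; exists K => //; split=> P ThP.
  exact: le_trans (Ka _ ThP) aa'.
exact: le_trans (Kb _ ThP) bb'.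
Qed.

(** The number [k] of repetitions is fixed first, from [c] and [e] alone; then
the base test is taken with a first kind error so small that [k] repetitions
do not bring it above [e]. *)
Lemma separable_amplify Theta0 Theta1 (c : R) : 0 <= c < 1 ->
  (forall e, 0 < e -> exists m, separable Theta0 Theta1 m e c) ->
  forall e, 0 < e -> \forall n \near \oo, separable Theta0 Theta1 n e e.
Proof.
move=> /andP[c0 c1] sep e e0.
have [k ck] : exists k, c ^+ k <= e.
  have /cvgrPdist_le/(_ e e0)[k _ /(_ k (leqnn k))] : c ^+ k @[k --> \oo] --> 0.
    by apply: cvg_expr; rewrite ger0_norm.
  by rewrite sub0r normrN ger0_norm ?exprn_ge0// => ?; exists k.
(* Dividing by [k.+1] rather than [k] also covers [k = 0]. *)
have [|m sepm] := sep (e / k.+1%:R); first by rewrite divr_gt0.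
exists (k * m)%N => // n /= kmn; apply: separable_widen kmn _.
apply: separableW (separable_repeat k sepm) => //.
rewrite -[leLHS]mulr_natr mulrAC ler_pdivrMr// ler_wpM2l ?ler_nat//.
exact: ltW.
Qed.

(** * Uniform consistency without suprema *)

(** The bounds 0 and 1 make the real supremum meaningful for nonempty [D]; for
empty [D] it is 0, which agrees with the right-hand side being vacuous. *)
Lemma sup_cvg0P (A : Type) (D : set A) (F : nat -> A -> R) :
  (forall n x, 0 <= F n x <= 1) ->
  sup [set F n x | x in D] @[n --> \oo] --> 0 <->
  forall e, 0 < e -> \forall n \near \oo, forall x, D x -> F n x <= e.
Proof.
move=> F01; have le_sup n x : D x -> F n x <= sup [set F n x | x in D].
  move=> Dx; apply: ub_le_sup; last by exists x.
  by exists 1 => _ [y _ <-]; have /andP[] := F01 n y.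
split=> [/cvgrPdist_le cv e e0|Fe].
  have := cv e e0; apply: filterS => n; rewrite sub0r normrN => le_e x Dx.
  by apply: le_trans (le_sup _ _ Dx) (le_trans (ler_norm _) le_e).
have [->|/set0P[x0 Dx0]] := eqVneq D set0.
  under eq_fun do rewrite image_set0 sup0; exact: cvg_cst.
apply/cvgrPdist_le => e e0; have := Fe e e0; apply: filterS => n le_e.
rewrite sub0r normrN ger0_norm.
  apply: ge_sup; first by exists (F n x0), x0.
  by move=> _ [x Dx <-]; exact: le_e.
by apply: le_trans (le_sup n _ Dx0); have /andP[] := F01 n x0.
Qed.

Lemma alphaP_itv n (K : n.-tuple T -> R) P : is_test K -> 0 <= alphaP K P <= 1.
Proof.
move=> tK; rewrite alphaP_ge0//=.
by have := betaP_ge0 P tK; rewrite betaP_alphaP// subr_ge0.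
Qed.

Lemma alpha_cvg0P Theta0 (K : forall n, n.-tuple T -> R) :
  (forall n, is_test (K n)) ->
  alpha (K n) Theta0 @[n --> \oo] --> 0 <->
  forall e, 0 < e ->
    \forall n \near \oo, forall P, Theta0 P -> alphaP (K n) P <= e.
Proof. by move=> tK; apply: sup_cvg0P => n P; exact: alphaP_itv. Qed.

Lemma beta_cvg0P Theta1 (K : forall n, n.-tuple T -> R) :
  (forall n, is_test (K n)) ->
  beta (K n) Theta1 @[n --> \oo] --> 0 <->
  forall e, 0 < e ->
    \forall n \near \oo, forall P, Theta1 P -> betaP (K n) P <= e.
Proof.
by move=> tK; apply: sup_cvg0P => n P; apply: alphaP_itv; exact: is_testC.
Qed.

Lemma uniformly_consistentP Theta0 Theta1 (K : forall n, n.-tuple T -> R) :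
  (forall n, is_test (K n)) ->
  uniformly_consistent Theta0 Theta1 K <->
  forall e, 0 < e -> \forall n \near \oo, separates Theta0 Theta1 e e (K n).
Proof.
move=> tK; rewrite /uniformly_consistent alpha_cvg0P// beta_cvg0P//.
split=> [[a0 b0] e e0|sep].
  by apply: filterS2 (a0 e e0) (b0 e e0) => n; split.
by split=> e e0; apply: filterS (sep e e0) => n [].
Qed.

End errors.

(** * The diagonal argument *)

(** If [Q i] holds from the rank [N i] on, then [s n] is the largest [i < n] with
[N i <= n]: the bound [i < n] makes the maximum exist, and every fixed [i] is
eventually allowed. *)
Lemma diagonal_index (Q : nat -> nat -> Prop) :
  (forall i, \forall n \near \oo, Q i n) ->
  exists s : nat -> nat,
    forall i, \forall n \near \oo, (i <= s n)%N /\ Q (s n) n.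
Proof.
move=> Qoo; have /choice[N QN] : forall i, exists N, forall n, (N <= n)%N -> Q i n.
  by move=> i; have [N _ QN] := Qoo i; exists N.
exists (fun n => (\max_(i < n | N i <= n) i)%N) => i.
exists (maxn (N i) i.+1) => // n /=; rewrite geq_max => /andP[Nin ltin].
have Hi : (N (Ordinal ltin) <= n)%N by [].
split; first exact: (@leq_bigmax_cond _ _ _ (Ordinal ltin) Hi).
have [|j Nj ->] := @eq_bigmax_cond 'I_n (fun i => N i <= n)%N (@nat_of_ord n).
  by apply/card_gt0P; exists (Ordinal ltin).
exact: QN.
Qed.

(** The test of size [n] is the one for the piece and the level of index [s n].
Nestedness transfers its second kind error to every earlier piece. *)
Lemma diagonal_test d (T : measurableType d) (R : realType)
    (Theta0 : set (probability T R)) (Theta1 : nat -> set (probability T R)) :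
  {homo Theta1 : i j / (i <= j)%N >-> i `<=` j} ->
  (forall i e, 0 < e ->
     \forall n \near \oo, separable Theta0 (Theta1 i) n e e) ->
  exists K : forall n, n.-tuple T -> R,
    (forall n, is_test (K n)) /\
    forall i, uniformly_consistent Theta0 (Theta1 i) K.
Proof.
move=> homo sep.
have [i|s sP] := @diagonal_index
  (fun i n => separable Theta0 (Theta1 i) n i.+1%:R^-1 i.+1%:R^-1).
  by apply: sep; rewrite invr_gt0.
have exK n : exists K : n.-tuple T -> R, is_test K /\
    (separable Theta0 (Theta1 (s n)) n (s n).+1%:R^-1 (s n).+1%:R^-1 ->
     separates Theta0 (Theta1 (s n)) (s n).+1%:R^-1 (s n).+1%:R^-1 K).
  have [[K tK KP]|nsep] := pselect (separable Theta0 (Theta1 (s n)) n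
    (s n).+1%:R^-1 (s n).+1%:R^-1).
    by exists K.
  (* For the finitely many sizes where no good test is known, any test does. *)
  have [K tK _] := separable01 (R := R) Theta0 (Theta1 0%N) n.
  by exists K.
pose K n := projT1 (cid (exK n)); have KP n := projT2 (cid (exK n)).
have tK n : is_test (K n) by have [] := KP n.
exists K; split=> // i; apply/uniformly_consistentP => // e e0.
have [k _ ke] := near_infty_natSinv_lt (PosNum e0).
apply: filterS (sP (maxn i k)) => n [ik_s sepn].
have [i_s k_s] : (i <= s n)%N /\ (k <= s n)%N.
  by move: ik_s; rewrite geq_max => /andP.
have es : (s n).+1%:R^-1 <= e by exact/ltW/ke.
have [_ /(_ sepn)] := KP n; rewrite -/(K n) => -[Ka Kb]; split=> P ThP.
  exact: le_trans (Ka _ ThP) es.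
exact: le_trans (Kb _ (homo _ _ i_s _ ThP)) es.
Qed.

(** * Consistency and distinguishability *)

Theorem theorem3p1 (R : realType) (Omega : ptopologicalType)
    (Theta0 Theta1 : set (probability (borel Omega) R)) :
  (exists K : forall n, n.-tuple (borel Omega) -> R,
      (forall n, is_test (K n)) /\ consistent Theta0 Theta1 K) <->
  (exists Theta1i : nat -> set (probability (borel Omega) R),
      [/\ forall i, Theta1i i `<=` Theta1i i.+1,
          Theta1 = \bigcup_i Theta1i i
        & forall i, distinguishable Theta0 (Theta1i i)]).
Proof.
split=> [[K [tK [/alpha_cvg0P a0 b0]]]|[Th [nested -> dist]]].
  (* The constant 1/2 could be any number strictly between 0 and 1. *)
  exists (fun i => [set P | Theta1 P /\
    forall n, (i <= n)%N -> betaP (K n) P <= 2^-1]); split.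
  - by move=> i P [ThP bP]; split=> // n /ltnW; exact: bP.
  - apply/seteqP; split=> [P ThP|P [i _ []]//].
    have half0 : 0 < 2^-1 :> R by [].
    have /cvgrPdist_le/(_ _ half0)[i _ bP] := b0 P ThP.
    exists i => //; split=> // n /bP.
    by rewrite sub0r normrN; exact: le_trans (ler_norm _).
  - move=> i; set Th := (X in distinguishable _ X).
    have sep e : 0 < e ->
        \forall n \near \oo, separable Theta0 Th n e e.
      apply: (@separable_amplify _ _ _ _ _ 2^-1); first by lra.
      (* The rank [i] gives the second kind error, the rank [N] the first. *)
      move=> {}e /(a0 tK)[N _ aN]; exists (maxn N i).
      exists (K (maxn N i)) => //; split=> [P|P [_ bP]].
        by apply: aN; rewrite /= leq_maxl.
      by apply: bP; rewrite leq_maxr.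
    have homTh : {homo (fun=> Th) : j k / (j <= k)%N >-> j `<=` k}.
      by move=> j k _ P.
    have [K' [tK' /(_ 0%N) cK']] := diagonal_test homTh (fun=> sep).
    by exists K'.
have [|i e e0|K [tK cK]] := @diagonal_test _ _ _ Theta0 Th.
- apply: (homo_leq _ _ nested); first exact: subset_refl.
  by move=> B A C; exact: subset_trans.
- have [K [tK /(uniformly_consistentP _ _ tK) sep]] := dist i.
  by apply: filterS (sep e e0) => n; exists (K n).
exists K; split=> //; split=> [|P [i _ ThP]]; first by have [] := cK 0%N.
apply/cvgrPdist_le => e e0.
have /uniformly_consistentP-/(_ tK e e0) := cK i; apply: filterS => n [_ bP].
by rewrite sub0r normrN ger0_norm ?betaP_ge0 ?bP.
Qed.
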